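(* Let $\mathcal K$ be a complete idempotent semiring, let $X$ be a complete right $\mathcal K$-semimodule, and let $V$ be a complete subsemimodule of $X$. Then for all $x\in X$ and $v\in V$, $$d_H(x,v)\le d_H(x,P_V(x)).$$
   Context: A semiring $(\mathcal K,\oplus,\otimes,\varepsilon,e)$ (neutral elements $\varepsilon$ for $\oplus$ and $e$ for $\otimes$, with $\varepsilon$ absorbing for $\otimes$) is idempotent if $a\oplus a=a$ for all $a$. An idempotent commutative monoid carries the natural order $a\le b\iff a\oplus b=b$. An ordered set is complete if every subset $U$ has a least upper bound $\bigvee U$ (it is then a complete lattice). A map $f$ between complete ordered sets is continuous if $f(\bigvee U)=\bigvee f(U)$ for every subset $U$ (including $U=\varnothing$). An idempotent semiring is complete if it is complete for its natural order and all its left and right multiplications are continuous. A right $\mathcal K$-semimodule is a commutative monoid $(X,\oplus,\varepsilon)$ with a right action $(x,\lambda)\mapsto x\lambda$ satisfying $x(\lambda\mu)=(x\lambda)\mu$, $(x\oplus y)\lambda=x\lambda\oplus y\lambda$, $x(\lambda\oplus\mu)=x\lambda\oplus x\mu$, $x\varepsilon=\varepsilon$, $xe=x$; its addition is then idempotent. It is complete if it is complete for its natural order and the maps $X\to X$, $x\mapsto x\lambda$ ($\lambda\in\mathcal K$) and $\mathcal K\to X$, $\mu\mapsto v\mu$ ($v\in X$) are all continuous. For $x,y\in X$: $x\backslash y=\max\{\lambda\in\mathcal K\mid x\lambda\le y\}$, and $d_H:X\times X\to\mathcal K$ is defined by $d_H(x,y)=(x\backslash y)(y\backslash x)$ (product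 in $\mathcal K$). A complete subsemimodule of $X$ is a subset stable under arbitrary suprema (of $X$) and under the action of scalars. For such $V$, $P_V(x)=\max\{v\in V\mid v\le x\}$. *)

(* Defs.v *)
From mathcomp Require Import all_boot all_algebra.
From mathcomp Require Import boolp classical_sets.

Set Implicit Arguments.
Unset Strict Implicit.
Unset Printing Implicit Defensive.

Import GRing.Theory.

Local Open Scope classical_set_scope.
Local Open Scope ring_scope.

Section NaturalOrder.
Variable M : nmodType.

Definition idempotent_add : Prop := forall a : M, a + a = a.

Definition oplus_le (a b : M) : Prop := a + b = b.

Definition is_lub (U : set M) (s : M) : Prop :=
  (forall u, U u -> oplus_le u s) /\
  (forall t, (forall u, U u -> oplus_le u t) -> oplus_le s t).

Definition is_max (U : set M) (m : M) : Prop :=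
  U m /\ forall u, U u -> oplus_le u m.

Definition order_complete : Prop := forall U : set M, exists s, is_lub U s.

(* Least upper bound and maximum as total functions; when there is none, the
   value is a dummy 0. Under idempotency they are unique, the natural order
   being antisymmetric. *)
Definition bigvee (U : set M) : M := xget 0 [set s | is_lub U s].
Definition maximum (U : set M) : M := xget 0 [set m | is_max U m].

End NaturalOrder.

Notation "a '<=+' b" := (oplus_le a b) (at level 70, no associativity).

Definition sup_continuous (M N : nmodType) (f : M -> N) : Prop :=
  forall U : set M, f (bigvee U) = bigvee (f @` U).

(* pzSemiRingType does not require 0 != 1, nor commutativity of *. *)
Definition complete_idempotent_semiring (K : pzSemiRingType) : Prop :=
  [/\ idempotent_add K,
      order_complete K,
      (forall a : K, sup_continuous (fun b : K => a * b))
    & (forall a : K, sup_continuous (fun b : K => b * a))].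

Section RightSemimodule.
(* A right K-semimodule is a left semimodule over the converse semiring K^c.
   The axiom a *: 0 = 0 of lSemiModType is no restriction: in a right
   semimodule, 0 a = (0 0) a = 0 (0 a) = 0 0 = 0. *)
Variables (K : pzSemiRingType) (X : lSemiModType K^c).

Definition ract (x : X) (a : K) : X := (a : K^c) *: x.

Lemma ractM (x : X) (a b : K) : ract x (a * b) = ract (ract x a) b.
Proof. by rewrite /ract scalerA. Qed.

(* Idempotency of the addition of X follows from that of K. *)
Definition complete_semimodule : Prop :=
  [/\ order_complete X,
      (forall a : K, sup_continuous (fun x : X => ract x a))
    & (forall v : X, sup_continuous (fun a : K => ract v a))].

Definition complete_subsemimodule (V : set X) : Prop :=
  (forall U : set X, U `<=` V -> V (bigvee U)) /\
  (forall (v : X) (a : K), V v -> V (ract v a)).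

Definition residual (x y : X) : K := maximum [set a : K | ract x a <=+ y].

Definition d_H (x y : X) : K := residual x y * residual y x.

Definition proj (V : set X) (x : X) : X := maximum [set v | V v /\ v <=+ x].

End RightSemimodule.

(* Main.v *)
(* Write p = P_V(x), a = x\v and b = v\x.  Then v b lies in V below x, so
   v b <= p and x (a b) <= v b <= p, that is a b <= x\p.  Since p <= x, also
   e <= p\x, whence a b = (a b) e <= (x\p)(p\x). *)
Require Import Defs.
From mathcomp Require Import all_boot all_algebra.
From mathcomp Require Import boolp classical_sets.

Import GRing.Theory.

Local Open Scope classical_set_scope.
Local Open Scope ring_scope.

Lemma oplus_le_trans {M : nmodType} {b a c : M} :
  a <=+ b -> b <=+ c -> a <=+ c.
Proof. by rewrite /oplus_le => ab <-; rewrite addrA ab. Qed.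

Lemma oplus_leM (K : pzSemiRingType) (a b c d : K) :
  a <=+ b -> c <=+ d -> a * c <=+ b * d.
Proof.
move=> ab cd; apply: (@oplus_le_trans _ (b * c)).
- by rewrite /oplus_le -mulrDl ab.
- by rewrite /oplus_le -mulrDr cd.
Qed.

Lemma ract_oplus_le (K : pzSemiRingType) (X : lSemiModType K^c) (x y : X)
  (a : K) : x <=+ y -> ract x a <=+ ract y a.
Proof. by rewrite /oplus_le /ract => xy; rewrite -scalerDr xy. Qed.

Lemma bigvee_is_lub (M : nmodType) (U : set M) :
  order_complete M -> is_lub U (bigvee U).
Proof. by move=> hM; exact: (xgetPex 0 (hM U)). Qed.

(** A supremum lying in its own set is a maximum of it. This witness keeps [maximum] from falling
    back on its dummy value, and reduces every existence of a maximum to one membership. *)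
Lemma maximum_is_max (M : nmodType) (U : set M) :
  order_complete M -> U (bigvee U) -> is_max U (maximum U).
Proof.
move=> hM Us; apply: (@xgetPex _ 0 [set m | is_max U m]).
by exists (bigvee U); split => //; exact: (bigvee_is_lub _ U hM).1.
Qed.

(** Continuity of [ract x] carries the supremum of the scalars to the supremum of their images; each
    image is below [y], hence so is that supremum. *)
Lemma residual_is_max (K : pzSemiRingType) (X : lSemiModType K^c) (x y : X) :
  complete_idempotent_semiring K -> complete_semimodule X ->
  is_max [set a : K | ract x a <=+ y] (residual x y).
Proof.
move=> [_ cK _ _] [cX _ contX]; apply: maximum_is_max => //=.
rewrite contX; apply: (bigvee_is_lub _ _ cX).2 => _ [a xa_le_y <-].
exact: xa_le_y.
Qed.

(** The supremum of the candidates stays in [V] by stability under suprema, and stays below [x]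
    because [x] bounds them all. *)
Lemma proj_is_max (K : pzSemiRingType) (X : lSemiModType K^c) (V : set X)
  (x : X) :
  complete_semimodule X -> complete_subsemimodule V ->
  is_max [set v | V v /\ v <=+ x] (proj V x).
Proof.
move=> [cX _ _] [Vsup _]; apply: maximum_is_max => //=; split.
- by apply: Vsup => v [].
- by apply: (bigvee_is_lub _ _ cX).2 => v [].
Qed.

Theorem theorem18 (K : pzSemiRingType) (hK : complete_idempotent_semiring K)
  (X : lSemiModType K^c) (hX : complete_semimodule X)
  (V : set X) (hV : complete_subsemimodule V)
  (x v : X) (hv : V v) :
  d_H x v <=+ d_H x (proj V x).
Proof.
have [[_ p_le_x] p_max] := proj_is_max _ _ V x hX hV.
have [xa_le_v _] := residual_is_max _ _ x v hK hX.
have [vb_le_x _] := residual_is_max _ _ v x hK hX.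
have [_ xp_max] := residual_is_max _ _ x (proj V x) hK hX.
have [_ px_max] := residual_is_max _ _ (proj V x) x hK hX.
rewrite /d_H -[X in X <=+ _]mulr1; apply: oplus_leM.
- apply: xp_max; rewrite /= ractM.
  (* Acting by [residual v x] preserves the bound [xa_le_v], so it remains to place the image of [v]
     below the projection. *)
  apply: (oplus_le_trans (ract_oplus_le _ _ _ _ _ xa_le_v)).
  by apply: p_max; split => //; exact: hV.2.
- by apply: px_max; rewrite /= /ract scale1r.
Qed.
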